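(* Let $U^n$, $n=2,\dots,N$, be the solution of the variable step-size BDF2 scheme $\bar\partial_B^2U^n+AU^n+BU^n=f^n$ ($n=2,\dots,N$) with starting approximations $U^0,U^1$, where $f:[0,T]\to H$. Let $r_{\max}\le R$ with $1<R<R_0=\sqrt2+1\approx2.414$, and set $c_3=\frac{(1+R)^2}{1+2R-R^2}$. If there exist constants $c_1$ and $c_2$ such that $k_{\max}$ satisfies $$(4+2\sqrt2)\gamma^2k_{\max}\le c_1<1\qquad\text{and}\qquad 2c_3\gamma^2k_{\max}\le c_2<1,$$ then for $n=2,3,\dots,N$ $$|U|^2_{l^\infty(t^2,t^n;H)}+\|U\|^2_{l^2(t^2,t^n;V)}\le Cf_U,$$ with $$f_U=|U^1|^2+k_{\max}\|U^1\|^2+(k_1^2+k_{\max}k_2)|\bar\partial U^1|^2+\sum_{j=2}^nk_j\big(\|f^j\|_*^2+k_{\max}|f^j|^2\big).$$ Here $C$ depends on $\gamma$, $c_i$ ($i=1,2,3$), $R$, $T$ and $\Phi_n$, where $$\Phi_n:=\sum_{j=2}^{n-2}[r_j-r_{j+2}]_+,\qquad[x]_+:=\frac{|x|+x}2.$$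
   Context: Let $(H,(\cdot,\cdot))$ be a Hilbert space with norm $|\cdot|$, and $A:D(A)\to H$ a positive definite, self-adjoint, linear operator with $D(A)$ dense in $H$. Let $V=D(A^{1/2})$ with norm $\|v\|=|A^{1/2}v|=(Av,v)^{1/2}$, and let $V^*$ be its dual, $V\subset H\subset V^*$, with norm $\|v\|_*=|A^{-1/2}v|$; $(\cdot,\cdot)$ also denotes the duality pairing between $V^*$ and $V$. $B$ is a linear operator with $|Bu|\le\gamma(t)\|u\|$ for all $u\in V$, $t\in J:=(0,T]$, where $\gamma:J\to\mathbb R$ is a smooth nonnegative function, and (without argument) $\gamma:=\max_{t\in J}\gamma(t)$. The underlying problem is $u'(t)+Au(t)+Bu(t)=f(t)$, $t\in J$, $u(0)=u^0$. Partition: $N\ge2$, $0=t^0<t^1<\dots<t^N=T$, $k_n=t^n-t^{n-1}$, $r_n=k_n/k_{n-1}$ and $s_n=r_n/(1+r_n)=k_n/(k_n+k_{n-1})$ for $n\ge2$; $k_{\max}=\max_{2\le n\le N}k_n$, $r_{\max}=\max_{2\le n\le N}r_n$; $f^n=f(t^n)$. Difference operators: $\bar\partial U^n=(U^n-U^{n-1})/k_n$ and $\bar\partial_B^2U^n=(1+s_n)\bar\partial U^n-s_n\bar\partial U^{n-1}$. The scheme is understood in variational form: $(\bar\partial_B^2U^n,v)+(AU^n,v)+(BU^n,v)=(f^n,v)$ for all $v\in V$, with $U^n\in V$; starting approximations $U^0\in H$, $U^1\in V$ are given. Norms: $|U|_{l^\infty(t^{n_1},t^{n_2};H)}=\max_{n_1\le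 j\le n_2}|U^j|$ and $\|U\|_{l^2(t^{n_1},t^{n_2};V)}=\big(\sum_{j=n_1}^{n_2}k_j\|U^j\|^2\big)^{1/2}$. Empty sums are $0$. *)

(* Defs.v *)
From HB Require Import structures.
From mathcomp Require Import all_boot all_order all_algebra.
From mathcomp Require Import all_classical all_reals all_analysis.
Import Order.TTheory GRing.Theory Num.Theory.
Import numFieldNormedType.Exports.

Set Implicit Arguments.
Unset Strict Implicit.
Unset Printing Implicit Defensive.

Local Open Scope classical_set_scope.
Local Open Scope ring_scope.

Section Operators.
Context {R : realType} {H : completeNormedModType R}.

(* A complete normed space whose norm satisfies this is a real Hilbert space;
   {dot H for idfun} is the type of symmetric positive definite bilinear
   forms. A complex Hilbert space is one as well, with Re (u, v) as form. *)
Definition hilbert_product (ip : {dot H for idfun}) :=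
  forall u : H, `|u| ^+ 2 = ip u u.

(* The values of [op] outside [dom] are irrelevant. *)
Record unbounded_operator := UnboundedOperator {
  dom : set H;
  op :> H -> H;
  dom0 : dom 0;
  dom_linear : forall (a : R) (u v : H), dom u -> dom v -> dom (a *: u + v);
  op_linear : forall (a : R) (u v : H),
    dom u -> dom v -> op (a *: u + v) = a *: op u + op v }.

Variable ip : {dot H for idfun}.

(* [self_adjoint A]: the left-hand side says that v lies in the domain of the
   adjoint of A and is mapped to w by it. *)
Definition self_adjoint (A : unbounded_operator) :=
  dense (dom A) /\
  forall v w : H,
    (forall u, dom A u -> ip (A u) v = ip u w) <-> (dom A v /\ A v = w).

Definition nonneg_operator (A : unbounded_operator) :=
  forall v, dom A v -> 0 <= ip (A v) v.

(* The lower bound m > 0 is what makes H embed into the dual of V, with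
   A^{-1/2} defined on all of H. *)
Definition positive_definite (A : unbounded_operator) :=
  exists2 m : R, 0 < m & forall v, dom A v -> m * `|v| ^+ 2 <= ip (A v) v.

(* S = A^{1/2}, the unique nonnegative self-adjoint operator with S S = A,
   the domain of S S being {v in dom S | S v in dom S}. *)
Definition is_sqrt_operator (A S : unbounded_operator) :=
  [/\ self_adjoint S, nonneg_operator S,
      forall v, dom A v <-> (dom S v /\ dom S (S v)) &
      forall v, dom A v -> A v = S (S v)].

Definition is_inverse_operator (S : unbounded_operator) (Sinv : H -> H) :=
  [/\ forall h, dom S (Sinv h), forall h, S (Sinv h) = h &
      forall v, dom S v -> Sinv (S v) = v].

(* In the following S stands for A^{1/2}, so that V = dom S. *)

Definition Vnorm (S : unbounded_operator) (v : H) : R := `|S v|.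

(* The duality pairing (A u, v) of V^* and V for u, v in V, where A : V -> V^*
   is the extension of A from its domain; it is ip (A u) v if u is in dom A. *)
Definition Apairing (S : unbounded_operator) (u v : H) : R := ip (S u) (S v).

End Operators.

Arguments unbounded_operator {R} H.

Section Perturbation.
Context {R : realType}.

(* Derivatives of all orders on ]0, T], at T in the sense of a smooth
   extension beyond T. *)
Definition smooth_on_J (T : R) (g : R -> R) :=
  exists2 h : R -> R, (forall x, 0 < x <= T -> g x = h x) &
    forall (n : nat) (x : R), 0 < x -> derivable (derive1n n h) x 1.

Definition is_max_on_J (T : R) (g : R -> R) (m : R) :=
  (g @` [set x | 0 < x <= T]) m /\ ubound (g @` [set x | 0 < x <= T]) m.

End Perturbation.

Section Partition.
Context {R : realType}.
Variable t : nat -> R.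

Definition is_partition (N : nat) (T : R) :=
  [/\ t 0%N = 0, t N = T & forall n, (n < N)%N -> t n < t n.+1].

Definition step (n : nat) : R := t n - t n.-1.
Definition ratio (n : nat) : R := step n / step n.-1.
Definition bdf_s (n : nat) : R := ratio n / (1 + ratio n).

(* Steps, ratios and norms are nonnegative, so that starting the maxima (here
   and in [linf_norm]) at 0 is harmless. *)
Definition step_max (N : nat) : R := \big[Num.max/0]_(2 <= n < N.+1) step n.
Definition ratio_max (N : nat) : R := \big[Num.max/0]_(2 <= n < N.+1) ratio n.

Definition pos_part (x : R) : R := (`|x| + x) / 2.

(* The index j ranges over 2, ..., n - 2. *)
Definition Phi (n : nat) : R :=
  \sum_(2 <= j < n.-1) pos_part (ratio j - ratio j.+2).

Context {H : completeNormedModType R}.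

Definition dbar (U : nat -> H) (n : nat) : H :=
  (step n)^-1 *: (U n - U n.-1).

Definition dbar_B2 (U : nat -> H) (n : nat) : H :=
  (1 + bdf_s n) *: dbar U n - bdf_s n *: dbar U n.-1.

Definition linf_norm (n1 n2 : nat) (U : nat -> H) : R :=
  \big[Num.max/0]_(n1 <= j < n2.+1) `|U j|.

Definition l2V_norm (S : unbounded_operator H) (n1 n2 : nat) (U : nat -> H) : R :=
  Num.sqrt (\sum_(n1 <= j < n2.+1) step j * Vnorm S (U j) ^+ 2).

(* [Sinv] stands for A^{-1/2}, so that `|Sinv v| is the norm of v in V^*. *)
Definition f_U (N : nat) (S : unbounded_operator H) (Sinv : H -> H)
    (f : R -> H) (U : nat -> H) (n : nat) : R :=
  `|U 1%N| ^+ 2 + step_max N * Vnorm S (U 1%N) ^+ 2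
  + (step 1 ^+ 2 + step_max N * step 2) * `|dbar U 1| ^+ 2
  + \sum_(2 <= j < n.+1)
      step j * (`|Sinv (f (t j))| ^+ 2 + step_max N * `|f (t j)| ^+ 2).

End Partition.

Definition c3_of {R : realType} (r : R) : R :=
  (1 + r) ^+ 2 / (1 + 2 * r - r ^+ 2).

(* Main.v *)
Require Import Defs.
From HB Require Import structures.
From mathcomp Require Import all_boot all_order all_algebra.
From mathcomp Require Import all_classical all_reals all_analysis.
From mathcomp Require Import ring lra.
Import Order.TTheory GRing.Theory Num.Theory.
Import numFieldNormedType.Exports.
Local Open Scope classical_set_scope.
Local Open Scope ring_scope.

(* Write s_n = r_n / (1 + r_n) and s = R / (1 + R), so that
   1 / c_3 = 1 - 2 s^2 > 0. Multiplying the scheme by (1 - s_n) k_n turns its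
   difference part into
   (1 - s_n^2) (U^n - U^{n-1}) - s_n^2 (U^{n-1} - U^{n-2}),
   and testing with 2 U^n gives
   |U^n|^2 - |U^{n-1}|^2 - s_n^2 (|U^n|^2 - |U^{n-2}|^2)
   up to a defect -|U^{n-1} - U^{n-2}|^2. Summation by parts leaves the factors
   [s_j^2 - s_{j+2}^2]_+ <= 2 [r_j - r_{j+2}]_+, whence Phi_n, and boundary
   terms that are absorbed because 2 s^2 < 1. The sum of the defects is at most
   k_max times the sum of k_j |dbar U^j|^2, which is bounded by testing the
   unweighted scheme with k_n dbar U^n. In both estimates the discrete Gronwall
   inequality concludes. *)

(** * Discrete Gronwall inequality *)

Lemma sum_nat_ge0 (R : realType) (m n : nat) (F : nat -> R) :
  (forall i, (m <= i < n)%N -> 0 <= F i) -> 0 <= \sum_(m <= i < n) F i.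
Proof. by move=> F0; rewrite big_nat; apply: sumr_ge0. Qed.

Lemma ler_sum_nat_widen (R : realType) (F : nat -> R) (l m n : nat) :
  (l <= m <= n)%N -> (forall j, (m <= j < n)%N -> 0 <= F j) ->
  \sum_(l <= j < m) F j <= \sum_(l <= j < n) F j.
Proof.
move=> /andP[lm mn] F0; rewrite (big_cat_nat lm mn)/= lerDl.
exact: sum_nat_ge0.
Qed.

Lemma tail_range (l m j n : nat) :
  (l <= m)%N -> (m <= j < n.+1)%N -> (l <= j <= n)%N.
Proof. by move=> lm /andP[mj jn]; rewrite (leq_trans lm mj). Qed.

(** The current value enters through [p m] and the previous one through [z m]; once both are
    absorbed, at least the fraction [d] remains on the left, hence the two divisions by [d]. The
    condition [z n0 = 0] keeps out the value before [n0], which is not controlled. *)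
Lemma discrete_gronwall (R : realType) (y h p z : nat -> R) (F d : R)
    (n0 n : nat) :
  0 < d -> 0 <= F -> z n0 = 0 ->
  (forall m, (n0 <= m <= n)%N ->
     [/\ 0 <= h m, 0 <= p m, 0 <= z m & p m + z m <= 1 - d]) ->
  (forall m, (n0 <= m <= n)%N ->
     y m <= F + p m * y m + z m * y m.-1 + \sum_(n0 <= j < m) h j * y j) ->
  forall m, (n0 <= m <= n)%N ->
    y m <= F / d * expR ((\sum_(n0 <= j < m) h j) / d).
Proof.
move=> d0 F0 z0 coef yle.
pose X m := expR ((\sum_(n0 <= j < m) h j) / d).
have Fd0 : 0 <= F / d by rewrite divr_ge0// ltW.
have FdE : F = d * (F / d) by rewrite mulrCA divff ?mulr1// gt_eqF.
(* With c = [F / d * X m] the assumptions give (1 - p) y <= (d + z) c, and d + z <= 1 - p. *)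
have y_bound m : (n0 <= m <= n)%N ->
    F + \sum_(n0 <= j < m) h j * y j <= F * X m ->
    z m * y m.-1 <= z m * (F / d * X m) -> y m <= F / d * X m.
  move=> mn sumle zle; have [h0 p0 zm0 pz] := coef m mn.
  have q0 : 0 < 1 - p m by lra.
  rewrite -(ler_pM2l q0).
  have X0 : 0 <= F / d * X m by rewrite mulr_ge0// expR_ge0.
  have : 0 <= (1 - d - (p m + z m)) * (F / d * X m)
    by rewrite mulr_ge0// subr_ge0.
  have := yle m mn; move: sumle zle X0; rewrite {1 2}FdE -mulrA.
  by move: (F / d * X m) (\sum_(n0 <= j < m) _) => a b; lra.
(* The bound on the partial sum is carried along: it takes in the next summand by 1 + x <= exp x,
   and [y_bound] converts it into the bound on [y]. *)
suff main i : (n0 + i <= n)%N -> y (n0 + i)%N <= F / d * X (n0 + i)%N /\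
    F + \sum_(n0 <= j < n0 + i) h j * y j <= F * X (n0 + i)%N.
  move=> m /andP[m0 mn].
  by have := main (m - n0)%N; rewrite subnKC// => /(_ mn)[].
elim: i => [|i IH] ni.
  rewrite addn0 in ni *.
  have rng : (n0 <= n0 <= n)%N by rewrite leqnn.
  have S0 : F + \sum_(n0 <= j < n0) h j * y j <= F * X n0.
    by rewrite /X !big_geq// addr0 mul0r expR0 mulr1.
  by split=> //; apply: y_bound => //; rewrite z0 !mul0r.
have ni' : (n0 + i <= n)%N by apply: leq_trans ni; rewrite leq_add2l.
have [yi Si] := IH ni'.
have rng : (n0 <= n0 + i <= n)%N by rewrite leq_addr.
have [h0 _ _ _] := coef _ rng.
have XS : X (n0 + i.+1)%N = X (n0 + i)%N * expR (h (n0 + i)%N / d).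
  by rewrite /X addnS big_nat_recr ?leq_addr//= mulrDl expRD.
have h0' : 0 <= h (n0 + i)%N / d by rewrite divr_ge0// ltW.
have X0 : 0 <= X (n0 + i)%N := expR_ge0 _.
have XSle : X (n0 + i)%N * (1 + h (n0 + i)%N / d) <= X (n0 + i.+1)%N.
  by rewrite XS ler_wpM2l// expR_ge1Dx.
have SS : F + \sum_(n0 <= j < n0 + i.+1) h j * y j <= F * X (n0 + i.+1)%N.
  rewrite addnS big_nat_recr ?leq_addr//= -addnS addrA.
  apply: le_trans (ler_wpM2l F0 XSle).
  have -> : F * (X (n0 + i)%N * (1 + h (n0 + i)%N / d)) =
      F * X (n0 + i)%N + h (n0 + i)%N * (F / d * X (n0 + i)%N) by ring.
  by rewrite lerD// ler_wpM2l.
have rng' : (n0 <= n0 + i.+1 <= n)%N by rewrite leq_addr.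
split=> //; apply: y_bound => //.
have [_ _ z0' _] := coef _ rng'.
rewrite ler_wpM2l// addnS /=; apply: (le_trans yi); rewrite ler_wpM2l// -addnS.
by apply: le_trans XSle; rewrite ler_peMr// lerDl.
Qed.

(** * Energy estimates for abstract real sequences *)

(* Testing the scheme with [dbar U n]: [d n] is [`|dbar U n| ^+ 2], [v n]
   and [G n] are the squared V-norm of [U n] and norm of [f n], and [g] is
   gamma^2. *)
Lemma increments_bound (R : realType) (k s d v G : nat -> R)
    (n : nat) (a b g c2 T : R) :
  (2 <= n)%N -> 0 < a -> a + b <= 1 -> 0 <= b -> 0 <= g -> c2 < 1 ->
  (forall j, 0 <= d j) -> (forall j, 0 <= v j) -> (forall j, 0 <= G j) ->
  (forall j, (2 <= j <= n)%N -> 0 <= k j) ->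
  (forall j, (2 <= j <= n)%N -> 0 <= s j <= 1) ->
  (forall j, (2 <= j < n)%N -> k j.+1 * s j.+1 <= 2 * b * k j) ->
  (forall j, (2 <= j <= n)%N -> 2 * g * k j <= c2 * a) ->
  \sum_(2 <= j < n.+1) k j <= T ->
  (forall j, (2 <= j <= n)%N ->
     k j * (1 + s j / 2) * d j - k j * s j / 2 * d j.-1
       + (v j - v j.-1) / 2
     <= a / 2 * k j * d j + g / a * (k j * v j) + a^-1 * (k j * G j)) ->
  \sum_(2 <= j < n.+1) k j * d j
  <= a^-1 * (1 + 2 * (g * T / a) *
        (expR (2 * (g * T / a) / (1 - c2)) / (1 - c2)))
     * (v 1%N + k 2%N * d 1%N + 2 / a * \sum_(2 <= j < n.+1) k j * G j).
Proof.
move=> n2 a0 ab b0 g0 c21 d0 v0 G0 k0 s01 kss gk kT stp.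
have Km : 0 <= \sum_(2 <= j < n.+1) k j * G j.
  by apply: sum_nat_ge0 => j jn; rewrite mulr_ge0// k0.
(* The term [b * (k i.+2 * d i.+2)] is a reserve for the [d j.-1] term of the next step, which costs
   no more because [k j.+1 * s j.+1 <= 2 * b * k j]; [a + b <= 1] renews the reserve. *)
have energy i : (i.+2 <= n)%N ->
    a / 2 * (\sum_(2 <= j < i.+3) k j * d j) + b * (k i.+2 * d i.+2)
      + v i.+2 / 2
    <= (v 1%N + k 2%N * d 1%N) / 2 + g / a * (\sum_(2 <= j < i.+3) k j * v j)
       + a^-1 * \sum_(2 <= j < i.+3) k j * G j.
  elim: i => [|i IH] ni.
    rewrite !big_nat1; have /= := stp 2%N ni.
    have k2 := k0 2%N ni; have /andP[s0 s1] := s01 2%N ni.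
    have kd2 : 0 <= k 2%N * d 2%N by rewrite mulr_ge0.
    have kd1 : 0 <= k 2%N * d 1%N by rewrite mulr_ge0.
    have A1 : 0 <= s 2%N * (k 2%N * d 2%N) by rewrite mulr_ge0.
    have A2 : 0 <= (1 - s 2%N) * (k 2%N * d 1%N)
      by rewrite mulr_ge0// subr_ge0.
    have A3 : 0 <= (1 - (a + b)) * (k 2%N * d 2%N)
      by rewrite mulr_ge0// subr_ge0.
    by lra.
  rewrite !(@big_nat_recr _ _ _ i.+3)//= !mulrDr.
  have rng : (2 <= i.+3 <= n)%N by [].
  have /= := stp i.+3 rng; have /= := IH (ltnW ni).
  have k3 := k0 _ rng; have /andP[s0 s1] := s01 _ rng.
  have kd3 : 0 <= k i.+3 * d i.+3 by rewrite mulr_ge0.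
  have A1 : 0 <= s i.+3 * (k i.+3 * d i.+3) by rewrite mulr_ge0.
  have A3 : 0 <= (1 - (a + b)) * (k i.+3 * d i.+3)
    by rewrite mulr_ge0// subr_ge0.
  have A2 : 0 <= (2 * b * k i.+2 - k i.+3 * s i.+3) * d i.+2.
    by rewrite mulr_ge0// subr_ge0 kss.
  by lra.
pose K := v 1%N + k 2%N * d 1%N + 2 / a * \sum_(2 <= j < n.+1) k j * G j.
have K0 : 0 <= K.
  by rewrite !addr_ge0// mulr_ge0// ?divr_ge0 ?k0// ltW.
have energyK m : (2 <= m <= n)%N ->
    a * (\sum_(2 <= j < m.+1) k j * d j) + v m
    <= K + 2 * g / a * (\sum_(2 <= j < m.+1) k j * v j).
  case: m => [|[|m]]// /= mn; have := energy m mn.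
  have bkd : 0 <= b * (k m.+2 * d m.+2) by rewrite !mulr_ge0// k0.
  have : a^-1 * \sum_(2 <= j < m.+3) k j * G j
      <= a^-1 * \sum_(2 <= j < n.+1) k j * G j.
    rewrite ler_wpM2l ?invr_ge0 ?(ltW a0)//.
    apply: ler_sum_nat_widen => // j jn.
    by rewrite mulr_ge0// k0// (tail_range _ _ _ _ _ jn).
  by rewrite /K; lra.
have sumd0 m : (2 <= m <= n)%N -> 0 <= \sum_(2 <= j < m.+1) k j * d j.
  move=> /andP[m2 mn]; apply: sum_nat_ge0 => j /andP[j2 jm].
  by rewrite mulr_ge0// k0// j2 (leq_trans (jm : (j <= m)%N)).
have d10 : 0 < 1 - c2 by rewrite subr_gt0.
have ga0 : 0 <= 2 * g / a by rewrite divr_ge0 ?mulr_ge0// ltW.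
(* The newest summand of the sum of [k j * v j] is split off as the implicit coefficient [p]; the
   step restriction bounds it by [c2], so [1 - c2] remains. *)
have v_le := @discrete_gronwall _ v (fun j => 2 * g / a * k j)
  (fun j => 2 * g / a * k j) (fun=> 0) K (1 - c2) 2 n d10 K0 erefl.
pose X := expR (2 * (g * T / a) / (1 - c2)) / (1 - c2).
have {}v_le m : (2 <= m <= n)%N -> v m <= K * X.
  move=> mn; apply: le_trans (v_le _ _ m mn) _; [move=> j jn|move=> j jn|].
  - have hj : 0 <= 2 * g / a * k j by rewrite mulr_ge0// k0.
    split=> //; rewrite addr0 opprB addrCA subrr addr0.
    by rewrite mulrAC ler_pdivrMr// gk.
  - rewrite mul0r addr0; have := energyK j jn; case/andP: (jn) => j2 _.
    have := mulr_ge0 (ltW a0) (sumd0 j jn).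
    have -> : \sum_(2 <= i < j) 2 * g / a * k i * v i =
        2 * g / a * \sum_(2 <= i < j) k i * v i.
      by rewrite mulr_sumr; apply: eq_bigr => i _; rewrite mulrA.
    by rewrite [X in _ <= _ + _ * X]big_nat_recr//= mulrDr; lra.
  - rewrite [leRHS](_ : _ = K / (1 - c2) * expR (2 * (g * T / a) / (1 - c2)));
      last by rewrite /X; ring.
    rewrite ler_wpM2l ?divr_ge0 ?(ltW d10)// ler_expR.
    rewrite ler_wpM2r ?invr_ge0 ?(ltW d10)//= -mulr_sumr.
    rewrite [leRHS](_ : _ = 2 * g / a * T); last by ring.
    apply/ler_wpM2l => //; apply: le_trans kT.
    case/andP: mn => m2 mn.
    apply: ler_sum_nat_widen => [|j jn]; first by rewrite m2 leqW.
    by rewrite k0// (tail_range _ _ _ _ m2 jn).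
have X0 : 0 <= X by rewrite divr_ge0 ?expR_ge0// ltW.
rewrite -mulrA ler_pdivlMl// mulrDl mul1r -/X -/K.
have := v0 n; have := energyK n; rewrite n2 leqnn => /(_ isT).
(* The uniform bound [K * X] on [v] is fed back into the energy inequality at [n]. *)
suff : 2 * g / a * (\sum_(2 <= j < n.+1) k j * v j)
    <= 2 * (g * T / a) * X * K by lra.
have -> : 2 * (g * T / a) * X * K = 2 * g / a * (T * (K * X)) by ring.
rewrite ler_wpM2l//; apply: (@le_trans _ _ (\sum_(2 <= j < n.+1) k j * (K * X))).
  by apply: ler_sum_nat => j jn; rewrite ler_wpM2l ?k0 ?v_le.
by rewrite -mulr_suml ler_wpM2r// mulr_ge0.
Qed.

(* Testing the scheme with [U n]: [e n] is [`|U n| ^+ 2] and [w n] is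
   [bdf_s n ^+ 2]; since [w n] multiplies [e n - e (n - 2)], summation by parts
   produces differences with an index shift of two. *)
Lemma solution_bound (R : realType) (k w phi e q v F : nat -> R)
    (n : nat) (a g rho T : R) :
  (2 <= n)%N -> 0 < a <= 1 -> 0 <= g -> 0 <= rho -> w 1%N = 0 ->
  (forall j, 0 <= phi j) -> (forall j, 0 <= e j) -> (forall j, 0 <= q j) ->
  (forall j, 0 <= v j) -> (forall j, 0 <= F j) ->
  (forall j, (2 <= j <= n)%N -> 0 <= k j) ->
  (forall j, (2 <= j <= n)%N -> 0 <= w j <= (1 - a) / 2) ->
  (forall j, (2 <= j)%N -> (j.+2 <= n)%N -> w j <= w j.+2 + phi j) ->
  (forall j, (2 <= j <= n)%N -> g * k j <= a / 2) ->
  \sum_(2 <= j < n.+1) k j <= T ->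
  (forall j, (2 <= j <= n)%N ->
     (e j - e j.-1) - w j * (e j - e j.-2) + rho * (k j * v j)
     <= q j.-1 + g * (k j * e j) + 2 * (k j * F j)) ->
  let P := \sum_(2 <= j < n) phi j + g * T in
  let Z := expR (P / (a / 2)) / (a / 2) in
  let D := e 1%N + \sum_(2 <= j < n.+1) q j.-1
           + 2 * \sum_(2 <= j < n.+1) k j * F j in
  (forall m, (2 <= m <= n)%N -> e m <= Z * D) /\
  rho * \sum_(2 <= j < n.+1) k j * v j <= (1 + Z * (1 + P)) * D.
Proof.
move=> n2 /andP[a0 a1] g0 rho0 w1 phi0 e0 q0 v0 F0 k0 wb wphi gk kT stp P Z D.
have ke0 j : (2 <= j <= n)%N -> 0 <= k j * e j.
  by move=> jn; rewrite mulr_ge0// k0.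
(* Shifting the index of [w j * e j.-2] leaves [(w j - w j.+2) * e j], at most [phi j * e j], and
   two boundary terms at the upper end. The terms with [w 2 * e 0] and [w 3 * e 1] have a favourable
   sign, and [w 1 = 0] gives the case [i = 0] the same form. *)
have energy i : (i.+2 <= n)%N ->
    e i.+2 + rho * (\sum_(2 <= j < i.+3) k j * v j)
    <= e 1%N + \sum_(2 <= j < i.+3) q j.-1
       + 2 * (\sum_(2 <= j < i.+3) k j * F j)
       + w i.+2 * e i.+2 + w i.+1 * e i.+1
       + \sum_(2 <= j < i.+1) phi j * e j
       + g * \sum_(2 <= j < i.+3) k j * e j.
  elim: i => [|i IH] ni.
    rewrite !big_nat1 big_geq// w1; have /= := stp 2%N ni.
    have : 0 <= w 2%N * e 0%N by rewrite mulr_ge0//; case/andP: (wb 2%N ni).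
    by lra.
  have rng : (2 <= i.+3 <= n)%N by [].
  have /= := stp i.+3 rng; have /= := IH (ltnW ni).
  rewrite !(@big_nat_recr _ _ _ i.+3)//= !mulrDr.
  case: i ni rng {IH} => [|i] ni rng.
    rewrite (@big_geq _ _ _ 2 1)// w1.
    have : 0 <= w 3%N * e 1%N by rewrite mulr_ge0//; case/andP: (wb 3%N rng).
    by lra.
  rewrite (@big_nat_recr _ _ _ i.+2)//=.
  have : 0 <= (w i.+4 + phi i.+2 - w i.+2) * e i.+2.
    by rewrite mulr_ge0// subr_ge0 wphi.
  by lra.
have D0 : 0 <= D.
  rewrite !addr_ge0// ?sum_nat_ge0// mulr_ge0// sum_nat_ge0// => j jn.
  by rewrite mulr_ge0// k0.
have energyD m : (2 <= m <= n)%N ->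
    e m + rho * (\sum_(2 <= j < m.+1) k j * v j)
    <= D + w m * e m + w m.-1 * e m.-1
       + \sum_(2 <= j < m) phi j * e j + g * \sum_(2 <= j < m.+1) k j * e j.
  case: m => [|[|m]]// /= mn; apply: (le_trans (energy m mn)).
  rewrite lerD2r lerD//.
    rewrite !lerD2r lerD//.
      rewrite lerD2l; apply: ler_sum_nat_widen => //.
    rewrite ler_wpM2l//; apply: ler_sum_nat_widen => // j jn.
    by rewrite mulr_ge0// k0// (tail_range _ _ _ _ _ jn).
  case: m mn => [|m] mn; first by rewrite !big_geq.
  by apply: ler_sum_nat_widen; rewrite ?leqnSn// => j _; rewrite mulr_ge0.
have ah : 0 < a / 2 by rewrite divr_gt0.
have P0 : 0 <= P.
  rewrite addr_ge0 ?sum_nat_ge0// mulr_ge0//; apply: le_trans kT.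
  exact: sum_nat_ge0.
have Z0 : 0 <= Z by rewrite divr_ge0 ?expR_ge0 ?ltW.
have e_le m : (2 <= m <= n)%N -> e m <= Z * D.
  move=> mn.
  (* [w j] and [w j.-1] are at most (1 - a) / 2 and [g * k j] at most a / 2, which leaves 1 - (1 -
     a) - a / 2 = [a / 2]; [w 1 = 0] makes the coefficient of the previous value vanish at the
     start. *)
  apply: le_trans (@discrete_gronwall _ e (fun j => phi j + g * k j)
    (fun j => w j + g * k j) (fun j => w j.-1) D (a / 2) 2 n ah D0 w1 _ _ m mn)
    _.
  - move=> j jn; have /andP[wj0 wja] := wb j jn.
    have gkj : 0 <= g * k j by rewrite mulr_ge0// k0.
    have : 0 <= w j.-1 <= (1 - a) / 2.
      case: j jn {wj0 wja gkj} => [|[|[|j]]]//= jn; last exact/wb/ltnW.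
      by rewrite w1 lexx divr_ge0// subr_ge0.
    move=> /andP[zj0 zja]; split=> //; rewrite ?addr_ge0//.
    by have := gk j jn; lra.
  - move=> j jn; have := energyD j jn.
    have : 0 <= rho * (\sum_(2 <= i < j.+1) k i * v i).
      rewrite mulr_ge0// sum_nat_ge0// => i /andP[i2 ij].
      rewrite mulr_ge0// k0// i2 (leq_trans (ij : (i <= j)%N))//.
      by case/andP: jn.
    case/andP: (jn) => j2 _.
    rewrite (@big_nat_recr _ _ _ j 2 (fun i => k i * e i))//=.
    have -> : \sum_(2 <= i < j) (phi i + g * k i) * e i =
        \sum_(2 <= i < j) phi i * e i + g * \sum_(2 <= i < j) k i * e i.
      by rewrite mulr_sumr -big_split/=; apply: eq_bigr => i _; ring.
    by lra.
  - rewrite /Z [leRHS](_ : _ = D / (a / 2) * expR (P / (a / 2))); last by ring.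
    rewrite ler_wpM2l ?divr_ge0 ?(ltW a0)// ler_expR.
    rewrite ler_wpM2r ?invr_ge0 ?divr_ge0 ?(ltW a0)// big_split/= -mulr_sumr lerD//.
      by apply: ler_sum_nat_widen.
    rewrite ler_wpM2l//; apply: le_trans kT; apply: ler_sum_nat_widen.
      by case/andP: mn => -> /= /leqW.
    case/andP: mn => m2 _ j jn.
    by rewrite k0// (tail_range _ _ _ _ m2 jn).
split=> //.
have nn : (2 <= n <= n)%N by rewrite n2 leqnn.
(* In the inequality at [n], [e n] absorbs [w n * e n], and the other occurrences of [e] are
   replaced by the uniform bound [M]. *)
have := energyD n nn; set M := Z * D in e_le *.
have M0 : 0 <= M by rewrite mulr_ge0.
have /andP[wn0 wna] := wb n nn.
have : 0 <= (1 - w n) * e n by rewrite mulr_ge0//; lra.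
have : w n.-1 * e n.-1 <= M.
  case: (n) n2 e_le wb => [|[|[|j]]]//= _ e_le' wb'; first by rewrite w1 mul0r.
  have rng : (2 <= j.+2 <= j.+3)%N by rewrite leqnSn.
  have /andP[? ?] := wb' _ rng; apply: le_trans (e_le' _ rng).
  by rewrite ler_piMl//; lra.
have : \sum_(2 <= j < n) phi j * e j <= (\sum_(2 <= j < n) phi j) * M.
  rewrite mulr_suml; apply: ler_sum_nat => j /andP[j2 jn].
  by rewrite ler_wpM2l// e_le// j2 ltnW.
have : g * \sum_(2 <= j < n.+1) k j * e j <= g * T * M.
  rewrite -mulrA ler_wpM2l//.
  apply: (@le_trans _ _ (\sum_(2 <= j < n.+1) k j * M)).
    by apply: ler_sum_nat => j jn; rewrite ler_wpM2l ?k0 ?e_le.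
  by rewrite -mulr_suml ler_wpM2r.
have -> : (1 + Z * (1 + P)) * D =
   D + M + (\sum_(2 <= j < n) phi j) * M + g * T * M by rewrite /M /P; ring.
by lra.
Qed.

(** * Inner product inequalities and operator domains *)

Section Testing.
Context {R : realType} {H : completeNormedModType R} (ip : {dot H for idfun}).
Hypothesis hip : hilbert_product ip.

Lemma dotC u v : ip u v = ip v u.
Proof. by rewrite hermC expr0 mul1r. Qed.

Lemma dotDr w u v : ip w (u + v) = ip w u + ip w v.
Proof. exact: linearDr. Qed.

Lemma dotDl u v w : ip (u + v) w = ip u w + ip v w.
Proof. by rewrite dotC dotDr (dotC w u) (dotC w v). Qed.

Lemma dotNr w u : ip w (- u) = - ip w u.
Proof. exact: linearNr. Qed.

Lemma dotNl u w : ip (- u) w = - ip u w.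
Proof. by rewrite dotC dotNr dotC. Qed.

Lemma dotZr c w u : ip w (c *: u) = c * ip w u.
Proof. exact: linearZr_LR. Qed.

Lemma dotZl c u w : ip (c *: u) w = c * ip u w.
Proof. by rewrite dotC dotZr dotC. Qed.

Lemma hilbert_normD (u v : H) :
  `|u + v| ^+ 2 = `|u| ^+ 2 + 2 * ip u v + `|v| ^+ 2.
Proof. by rewrite !hip dotDl !dotDr (dotC v u); ring. Qed.

Lemma hilbert_normB (u v : H) :
  `|u - v| ^+ 2 = `|u| ^+ 2 - 2 * ip u v + `|v| ^+ 2.
Proof. by rewrite hilbert_normD normrN dotNr; ring. Qed.

(** Cauchy-Schwarz, read off from the squared triangle inequality of the given norm. *)
Lemma dot_le_norms (u v : H) : ip u v <= `|u| * `|v|.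
Proof.
have : `|u + v| ^+ 2 <= (`|u| + `|v|) ^+ 2.
  by rewrite ler_sqr ?nnegrE ?addr_ge0// ler_normD.
by rewrite hilbert_normD; lra.
Qed.

Lemma dot_ge_norms (u v : H) : - (`|u| * `|v|) <= ip u v.
Proof. by have := dot_le_norms (- u) v; rewrite normrN dotNl; lra. Qed.

(* Multiplied by [1 - s], the scheme becomes symmetric in the one-step and
   two-step differences of the squared norms. *)
Lemma weighted_bdf2_test (u p w : H) (c : R) : 0 <= c <= 1 / 2 ->
  `|u| ^+ 2 - `|p| ^+ 2 - c * (`|u| ^+ 2 - `|w| ^+ 2) - `|p - w| ^+ 2
  <= 2 * ip ((1 - c) *: (u - p) - c *: (p - w)) u.
Proof.
move=> /andP[c0 c1].
(* The tested vector is (u - p) - c (u - w), and 2 (u - p, u) = |u|^2 - |p|^2 + |u - p|^2, likewise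
   for w. *)
have -> : 2 * ip ((1 - c) *: (u - p) - c *: (p - w)) u =
    `|u| ^+ 2 - `|p| ^+ 2 - c * (`|u| ^+ 2 - `|w| ^+ 2) + `|u - p| ^+ 2
    - c * `|u - w| ^+ 2.
  rewrite dotDl dotNl !dotZl !dotDl !dotNl !hilbert_normB !hip.
  by rewrite (dotC p u) (dotC w u); ring.
(* Since 2 c <= 1, c |u - w|^2 is covered by |u - p|^2 from the identity and the permitted defect |p
   - w|^2. *)
have : `|u - w| ^+ 2 <= 2 * `|u - p| ^+ 2 + 2 * `|p - w| ^+ 2.
  have -> : u - w = (u - p) + (p - w) by rewrite addrA subrK.
  rewrite hilbert_normD; have := sqr_ge0 `|(u - p) - (p - w)|.
  by rewrite (hilbert_normB (u - p)); lra.
move=> /(ler_wpM2l c0).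
have : 0 <= (1 - 2 * c) * `|u - p| ^+ 2 by rewrite mulr_ge0 ?sqr_ge0//; lra.
have : 0 <= (1 - 2 * c) * `|p - w| ^+ 2 by rewrite mulr_ge0 ?sqr_ge0//; lra.
by lra.
Qed.

Lemma op0 (S : unbounded_operator H) : S 0 = 0.
Proof.
have := op_linear 1 (dom0 S) (dom0 S); rewrite !scale1r addr0 => /eqP.
by rewrite -subr_eq subrr eq_sym => /eqP.
Qed.

Lemma dom_scaleB (S : unbounded_operator H) (c : R) (u v : H) :
  dom S u -> dom S v -> dom S (c *: (u - v)).
Proof.
move=> du dv; have dNv := dom_linear (- c) dv (dom0 S).
by rewrite scalerBr -scaleNr -[_ *: v]addr0; apply: dom_linear.
Qed.

Lemma op_scaleB (S : unbounded_operator H) (c : R) (u v : H) :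
  dom S u -> dom S v -> S (c *: (u - v)) = c *: (S u - S v).
Proof.
move=> du dv; have dNv := dom_linear (- c) dv (dom0 S).
have -> : c *: (u - v) = c *: u + ((- c) *: v + 0).
  by rewrite scalerBr addr0 scaleNr.
by rewrite !op_linear//; [rewrite op0 addr0 scaleNr scalerBr|exact: dom0].
Qed.

Lemma self_adjoint_sym (S : unbounded_operator H) (u v : H) :
  self_adjoint ip S -> dom S u -> dom S v -> ip (S u) v = ip u (S v).
Proof. by move=> [_ /(_ v (S v))[_ adj]] du dv; apply: adj. Qed.

End Testing.

(** * Scalar inequalities and properties of the partition *)

Section ScalarFacts.
Context {R : realType}.
Implicit Type t : nat -> R.

Lemma pos_part_ge0 (x : R) : 0 <= pos_part x.
Proof. by rewrite /pos_part divr_ge0//; have := ler_norm (- x); rewrite normrN; lra. Qed.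

Lemma ler_pos_part (x : R) : x <= pos_part x.
Proof. by rewrite /pos_part; have := ler_norm x; lra. Qed.

Lemma ler_ratio1D (x y : R) : 0 <= x -> x <= y -> x / (1 + x) <= y / (1 + y).
Proof.
move=> x0 xy; rewrite ler_pdivrMr ?ltr_pwDl// mulrAC ler_pdivlMr ?ltr_pwDl//.
  by lra.
exact: le_trans xy.
Qed.

(** The map x / (1 + x) is increasing, 1-Lipschitz and at most 1 on the nonnegative reals, so its
    square has Lipschitz constant 2. This passes from differences of s_j^2 to the ratio differences
    in Phi_n. *)
Lemma sqr_ratio1DB (x y : R) : 0 <= x -> 0 <= y ->
  (x / (1 + x)) ^+ 2 <= (y / (1 + y)) ^+ 2 + 2 * pos_part (x - y).
Proof.
move=> x0 y0; have p0 := pos_part_ge0 (x - y).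
have [xy|yx] := leP x y.
  apply: ler_wpDr; first by rewrite mulr_ge0.
  by rewrite ler_sqr ?nnegrE ?ler_ratio1D ?divr_ge0 ?addr_ge0.
have x1 : 0 < 1 + x by rewrite ltr_pwDl.
have y1 : 0 < 1 + y by rewrite ltr_pwDl.
have r1 (z : R) : 0 <= z -> z / (1 + z) <= 1.
  by move=> z0; rewrite ler_pdivrMr ?ltr_pwDl// mul1r lerDr.
have : x / (1 + x) - y / (1 + y) <= x - y.
  have -> : x / (1 + x) - y / (1 + y) = (x - y) / ((1 + x) * (1 + y)).
    by field; rewrite !gt_eqF.
  rewrite ler_pdivrMr ?mulr_gt0// ler_peMr ?subr_ge0 1?ltW//.
  by have := mulr_ge0 x0 y0; lra.
have := ler_pos_part (x - y); have := r1 _ x0; have := r1 _ y0.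
have := ler_ratio1D _ _ y0 (ltW yx).
have : 0 <= y / (1 + y) by rewrite divr_ge0// ltW.
by nra.
Qed.

Lemma partition_le t (N : nat) (T : R) (m n : nat) : is_partition t N T ->
  (m <= n <= N)%N -> t m <= t n.
Proof.
move=> [_ _ tS] /andP[mn nN]; rewrite -(subnKC mn).
have : (m + (n - m) <= N)%N by rewrite subnKC.
elim: (n - m)%N => [|i IH]; first by rewrite addn0.
rewrite addnS => mi; apply: (le_trans (IH (ltnW mi))).
exact/ltW/tS.
Qed.

Lemma step_gt0 t (N : nat) (T : R) (n : nat) : is_partition t N T ->
  (1 <= n <= N)%N -> 0 < step t n.
Proof. by move=> [_ _ tS]; case: n => // n /= nN; rewrite subr_gt0 tS. Qed.

Lemma sum_step_le t (N : nat) (T : R) (n : nat) : is_partition t N T ->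
  (2 <= n <= N)%N -> \sum_(2 <= j < n.+1) step t j <= T.
Proof.
move=> tP /andP[n2 nN]; rewrite big_add1 /= /step.
have n1 : (1 <= n)%N by exact: ltnW.
rewrite telescope_sumr// lerBlDr.
have [t0 tN _] := tP; rewrite -tN ler_wpDr//.
  by rewrite -t0 (partition_le _ _ _ _ _ tP)// (leq_trans n1).
by rewrite (partition_le _ _ _ _ _ tP)// nN/=.
Qed.

Lemma step_le_max t (N n : nat) : (2 <= n <= N)%N -> step t n <= step_max t N.
Proof.
by move=> nN; apply: (@le_bigmax_seq _ _ _ _ _ n); rewrite ?mem_index_iota.
Qed.

Lemma ratio_le_max t (N n : nat) : (2 <= n <= N)%N ->
  Defs.ratio t n <= ratio_max t N.
Proof.
by move=> nN; apply: (@le_bigmax_seq _ _ _ _ _ n); rewrite ?mem_index_iota.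
Qed.

(** A completed square. With weight [a / 4], the contributions of B and f together cost [a / 2] in
    [increment_test]. *)
Lemma weighted_young (a x y : R) : 0 < a -> x * y <= a / 4 * y ^+ 2 + x ^+ 2 / a.
Proof.
move=> a0; rewrite -subr_ge0.
have -> : a / 4 * y ^+ 2 + x ^+ 2 / a - x * y = (a / 2 * y - x) ^+ 2 / a.
  by field; rewrite gt_eqF.
by rewrite divr_ge0 ?sqr_ge0// ltW.
Qed.

End ScalarFacts.

(** * Energy inequalities of a single time step *)

Section Steps.
Context {R : realType} {H : completeNormedModType R} (ip : {dot H for idfun}).
Hypothesis hip : hilbert_product ip.
Variables (S : unbounded_operator H) (t : nat -> R) (U : nat -> H) (n : nat).
Variables (Bu fn : H) (g : R).
Hypotheses (k_gt0 : 0 < step t n) (dU : dom S (U n)).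
Hypothesis Bu_le : `|Bu| <= g * Vnorm S (U n).

(** With k' the previous step, 1 - s = k' / (k + k') and (1 - s) k / k' = s; hence the coefficients
    (1 - s)(1 + s) and s^2. *)
Lemma weighted_dbar_B2 : 0 < step t n.-1 ->
  ((1 - bdf_s t n) * step t n) *: dbar_B2 t U n
  = (1 - bdf_s t n ^+ 2) *: (U n - U n.-1)
    - bdf_s t n ^+ 2 *: (U n.-1 - U n.-2).
Proof.
move=> k'_gt0; rewrite /dbar_B2 /dbar scalerBr !scalerA.
have kk' : step t n.-1 + step t n != 0 by rewrite gt_eqF// addr_gt0.
congr (_ *: _ - _ *: _); rewrite /bdf_s /Defs.ratio; field;
  by rewrite kk' !gt_eqF.
Qed.

(** This is [weighted_bdf2_test] with c = s_n^2 together with bounds on B and f; the defect is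
    rewritten as the squared previous step times the squared difference quotient. *)
Lemma solution_test (Sinv : H -> H) :
  self_adjoint ip S -> is_inverse_operator S Sinv ->
  0 < step t n.-1 -> 0 <= bdf_s t n -> bdf_s t n ^+ 2 <= 1 / 2 ->
  ip (dbar_B2 t U n) (U n) + Apairing ip S (U n) (U n) + ip Bu (U n)
    = ip fn (U n) ->
  (`|U n| ^+ 2 - `|U n.-1| ^+ 2)
    - bdf_s t n ^+ 2 * (`|U n| ^+ 2 - `|U n.-2| ^+ 2)
    + (1 - bdf_s t n) / 2 * (step t n * Vnorm S (U n) ^+ 2)
  <= step t n.-1 ^+ 2 * `|dbar t U n.-1| ^+ 2
     + (1 - bdf_s t n) * (g ^+ 2 * (step t n * `|U n| ^+ 2))
     + (1 - bdf_s t n) * (2 * (step t n * `|Sinv fn| ^+ 2)).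
Proof.
move=> Sadj [dSinv SSinv _] k'0 s0 s2 scheme.
set s := bdf_s t n in s0 s2 *; set k := step t n; have k0 : 0 < k := k_gt0.
have s1 : 0 <= 1 - s by nra.
(* Only the dual norm is spent on f: it is written as [S (Sinv fn)] and [S] is moved to the other
   factor by symmetry. *)
have fU : ip fn (U n) <= `|Sinv fn| * Vnorm S (U n).
  rewrite -{1}(SSinv fn) (self_adjoint_sym _ _ _ _ Sadj)//.
  exact: dot_le_norms.
have BU : - (g * Vnorm S (U n) * `|U n|) <= ip Bu (U n).
  have := dot_ge_norms _ hip Bu (U n).
  by have := ler_wpM2r (normr_ge0 (U n)) Bu_le; lra.
have AU : Apairing ip S (U n) (U n) = Vnorm S (U n) ^+ 2 by rewrite /Vnorm hip.
(* Of the available 2 |S U^n|^2, Young's inequality spends one copy on B and half a copy on f. *)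
have unweighted : 2 * ip (dbar_B2 t U n) (U n) + Vnorm S (U n) ^+ 2 / 2 <=
    g ^+ 2 * `|U n| ^+ 2 + 2 * `|Sinv fn| ^+ 2.
  have := sqr_ge0 (g * `|U n| - Vnorm S (U n)).
  have := sqr_ge0 (2 * `|Sinv fn| - Vnorm S (U n)).
  by move: scheme; rewrite AU; nra.
have c0 : 0 <= (1 - s) * k by rewrite mulr_ge0// ltW.
have := ler_wpM2l c0 unweighted.
have -> : step t n.-1 ^+ 2 * `|dbar t U n.-1| ^+ 2 = `|U n.-1 - U n.-2| ^+ 2.
  rewrite /dbar normrZ ger0_norm ?invr_ge0 ?(ltW k'0)// exprMn mulrA.
  by rewrite exprVn divff ?mul1r// expf_neq0// gt_eqF.
have := @weighted_bdf2_test _ _ _ hip (U n) (U n.-1) (U n.-2) (s ^+ 2).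
rewrite sqr_ge0 s2 => /(_ isT).
by rewrite -weighted_dbar_B2// dotZl -/s -/k; lra.
Qed.

(** With D and D' the current and previous quotients, s (D', D) is at most s (|D|^2 + |D'|^2) / 2,
    and k (A U^n, D) telescopes up to a nonnegative square. The Young parameter [a] becomes 1 / c_3
    later. *)
Lemma increment_test (a : R) :
  0 < a -> 0 <= bdf_s t n -> dom S (U n.-1) ->
  ip (dbar_B2 t U n) (dbar t U n) + Apairing ip S (U n) (dbar t U n)
    + ip Bu (dbar t U n) = ip fn (dbar t U n) ->
  step t n * (1 + bdf_s t n / 2) * `|dbar t U n| ^+ 2
    - step t n * bdf_s t n / 2 * `|dbar t U n.-1| ^+ 2
    + (Vnorm S (U n) ^+ 2 - Vnorm S (U n.-1) ^+ 2) / 2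
  <= a / 2 * step t n * `|dbar t U n| ^+ 2
     + g ^+ 2 / a * (step t n * Vnorm S (U n) ^+ 2)
     + a^-1 * (step t n * `|fn| ^+ 2).
Proof.
move=> a0 s0 dU' scheme.
set s := bdf_s t n in s0 *; set k := step t n; have k0 : 0 < k := k_gt0.
set D := dbar t U n in scheme *; set D' := dbar t U n.-1.
have BD : - (a / 4 * `|D| ^+ 2 + g ^+ 2 / a * Vnorm S (U n) ^+ 2) <= ip Bu D.
  have := dot_ge_norms _ hip Bu D.
  have := ler_wpM2r (normr_ge0 D) Bu_le.
  have := weighted_young a (g * Vnorm S (U n)) `|D| a0.
  by rewrite exprMn; lra.
have fD : ip fn D <= a / 4 * `|D| ^+ 2 + a^-1 * `|fn| ^+ 2.
  have := weighted_young a `|fn| `|D| a0.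
  by have := dot_le_norms _ hip fn D; lra.
have BDF : (1 + s / 2) * `|D| ^+ 2 - s / 2 * `|D'| ^+ 2
    <= ip (dbar_B2 t U n) D.
  rewrite /dbar_B2 -/D -/D' -/s dotDl dotNl (dotZl _ _ D) (dotZl _ _ D') -(hip D).
  have := sqr_ge0 `|D' - D|; rewrite (hilbert_normB _ hip).
  by move=> /(ler_wpM2l s0); lra.
have AD : (Vnorm S (U n) ^+ 2 - Vnorm S (U n.-1) ^+ 2) / 2
    <= k * Apairing ip S (U n) D.
  rewrite /Apairing /D /dbar op_scaleB// dotZr mulrA -/k.
  rewrite divff ?gt_eqF// mul1r dotDr dotNr -(hip (S (U n))) /Vnorm.
  have := sqr_ge0 `|S (U n) - S (U n.-1)|; rewrite (hilbert_normB _ hip).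
  by lra.
have : k * ((1 + s / 2) * `|D| ^+ 2 - s / 2 * `|D'| ^+ 2)
    <= k * ip (dbar_B2 t U n) D by rewrite ler_pM2l.
have : k * (ip fn D - ip Bu D) <= k * (a / 2 * `|D| ^+ 2 + a^-1 * `|fn| ^+ 2
    + g ^+ 2 / a * Vnorm S (U n) ^+ 2) by rewrite ler_pM2l//; lra.
rewrite -scheme.
by lra.
Qed.

End Steps.

(** * The constants and the final assembly *)

(** Positivity is the condition (r - 1)^2 < 2, that is r < 1 + sqrt 2 for r > 1. The last claim,
    which reduces to r <= 3, is [a + b <= 1] of [increments_bound]. *)
Lemma inv_c3E (R : realType) (r : R) : 1 < r -> r < Num.sqrt 2 + 1 ->
  [/\ (c3_of r)^-1 = 1 - 2 * (r / (1 + r)) ^+ 2, 0 < (c3_of r)^-1,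
      (c3_of r)^-1 <= 1 & (c3_of r)^-1 + r ^+ 2 / (2 * (1 + r)) <= 1].
Proof.
move=> r1 rs.
have sq2 : (r - 1) ^+ 2 < 2.
  have -> : (2 : R) = Num.sqrt 2 ^+ 2 by rewrite sqr_sqrtr.
  by rewrite ltr_pXn2r ?nnegrE ?sqrtr_ge0 ?subr_ge0 1?ltW//; lra.
have num0 : 0 < 1 + 2 * r - r ^+ 2 by nra.
have r0 : 0 < 1 + r by lra.
have E : (c3_of r)^-1 = (1 + 2 * r - r ^+ 2) / (1 + r) ^+ 2.
  by rewrite /c3_of invf_div.
have sqr0 : 0 < (1 + r) ^+ 2 by rewrite exprn_gt0.
split.
- by rewrite E; field; rewrite gt_eqF.
- by rewrite E divr_gt0.
- by rewrite E ler_pdivrMr//; nra.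
- rewrite E -subr_ge0 [leRHS](_ : _ = r ^+ 2 * (3 - r) / (2 * (1 + r) ^+ 2));
    last by field; rewrite gt_eqF.
  have r3 : 0 <= 3 - r by nra.
  by apply: divr_ge0; apply: mulr_ge0 => //; exact: sqr_ge0.
Qed.

(** [P] and [Z] are those of [solution_bound] with 2 Phi_n for the sum of [phi]; [X] is the Gronwall
    factor of [increments_bound], and [Y] bounds the data of [solution_bound] by multiples of f_U.
    The summand [Z] serves the maximum norm, the other one the V-norm. *)
Definition stability_constant (R : realType) (g c2 c3 r T Phin : R) : R :=
  let a := c3^-1 in
  let P := 2 * Phin + g ^+ 2 * T in
  let Z := expR (P / (a / 2)) / (a / 2) in
  let X := expR (2 * (g ^+ 2 * T / a) / (1 - c2)) / (1 - c2) in
  let Y := 2 + 2 / a * (a^-1 * (1 + 2 * (g ^+ 2 * T / a) * X)) in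
  (Z + 2 * (1 + r) * (1 + Z * (1 + P))) * Y.

Theorem theorem3p3 (R : realType) :
  exists C : forall gmax c1 c2 c3 Rb T Phin : R, R,
  forall (H : completeNormedModType R) (ip : {dot H for idfun})
    (A Ahalf : unbounded_operator H) (Ahalfinv : H -> H)
    (T : R) (gamma : R -> R) (gmax : R) (B : R -> H -> H) (f : R -> H)
    (N : nat) (t : nat -> R) (U : nat -> H) (Rb c1 c2 : R),
  hilbert_product ip ->
  self_adjoint ip A -> positive_definite ip A ->
  is_sqrt_operator ip A Ahalf -> is_inverse_operator Ahalf Ahalfinv ->
  smooth_on_J T gamma ->
  (forall x, 0 < x <= T -> 0 <= gamma x) ->
  is_max_on_J T gamma gmax ->
  (forall x, 0 < x <= T -> forall (a : R) (u v : H), dom Ahalf u -> dom Ahalf v ->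
     B x (a *: u + v) = a *: B x u + B x v) ->
  (forall x, 0 < x <= T -> forall u : H, dom Ahalf u ->
     `|B x u| <= gamma x * Vnorm Ahalf u) ->
  (2 <= N)%N -> is_partition t N T ->
  (forall n : nat, (1 <= n <= N)%N -> dom Ahalf (U n)) ->
  (forall n : nat, (2 <= n <= N)%N -> forall v : H, dom Ahalf v ->
     ip (dbar_B2 t U n) v + Apairing ip Ahalf (U n) v + ip (B (t n) (U n)) v
     = ip (f (t n)) v) ->
  ratio_max t N <= Rb -> 1 < Rb -> Rb < Num.sqrt 2 + 1 ->
  (4 + 2 * Num.sqrt 2) * gmax ^+ 2 * step_max t N <= c1 -> c1 < 1 ->
  2 * c3_of Rb * gmax ^+ 2 * step_max t N <= c2 -> c2 < 1 ->
  forall n : nat, (2 <= n <= N)%N ->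
    linf_norm 2 n U ^+ 2 + l2V_norm t Ahalf 2 n U ^+ 2
    <= C gmax c1 c2 (c3_of Rb) Rb T (Phi t n)
       * f_U t N Ahalf Ahalfinv f U n.
Proof.
exists (fun g _ c2 c3 r T Phin => stability_constant R g c2 c3 r T Phin).
move=> H ip A S Sinv T gamma gmax B f N t U Rb c1 c2 hip _ _ [Sadj _ _ _] Sinv_inv
  _ gamma0 [[x0 x0J gx0] gamma_le] _ B_le _ tP dU scheme rmax R1 R2 _ _ hc2 c21
  n /andP[n2 nN].
have [aE a0 a1 ab] := inv_c3E _ _ R1 R2.
rewrite /stability_constant; set a := (c3_of Rb)^-1 in aE a0 a1 ab *.
set b := Rb ^+ 2 / (2 * (1 + Rb)) in ab.
have Rb0 : 0 < 1 + Rb by lra.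
have b0 : 0 <= b by rewrite divr_ge0 ?sqr_ge0// mulr_ge0 ?ltW.
have g0 : 0 <= gmax by rewrite -gx0 gamma0.
have gg0 : 0 <= gmax ^+ 2 := sqr_ge0 _.
have rngN j : (2 <= j <= n)%N -> (2 <= j <= N)%N.
  by case/andP=> -> jn; exact: leq_trans nN.
have rng1 j : (2 <= j <= N)%N -> (1 <= j.-1 <= N)%N.
  by case: j => [|[|j]]//= jN; exact: ltnW.
have kpos j : (1 <= j <= N)%N -> 0 < step t j by move=> jN; exact: step_gt0 tP jN.
have k0 j : (2 <= j <= n)%N -> 0 <= step t j.
  by move=> /rngN /andP[j2 jN]; rewrite ltW// kpos// (ltnW j2).
have kmax0 : 0 <= step_max t N.
  by apply: le_trans (k0 n _) (step_le_max _ _ _ _); rewrite n2 ?leqnn.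
have r_ge0 j : (2 <= j <= N)%N -> 0 <= Defs.ratio t j.
  move=> jN.
  apply: divr_ge0; apply/ltW/kpos; last exact: rng1.
  by case/andP: jN => /ltnW ->.
have r_le j : (2 <= j <= N)%N -> Defs.ratio t j <= Rb.
  by move=> jN; exact: le_trans (ratio_le_max _ _ _ jN) rmax.
have s_ge0 j : (2 <= j <= N)%N -> 0 <= bdf_s t j.
  by move=> jN; rewrite divr_ge0 ?addr_ge0 ?r_ge0.
have s_le j : (2 <= j <= N)%N -> bdf_s t j <= Rb / (1 + Rb).
  by move=> jN; apply: ler_ratio1D; rewrite ?r_ge0 ?r_le.
have sig1 : Rb / (1 + Rb) = 1 - (1 + Rb)^-1 by field; rewrite gt_eqF.
have iRb0 : 0 < (1 + Rb)^-1 by rewrite invr_gt0.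
have w_le j : (2 <= j <= N)%N -> bdf_s t j ^+ 2 <= (1 - a) / 2.
  move=> jN; rewrite aE.
  have : bdf_s t j ^+ 2 <= (Rb / (1 + Rb)) ^+ 2.
    rewrite ler_sqr ?nnegrE ?s_le ?s_ge0//.
    by rewrite divr_ge0 ?ltW//; lra.
  by lra.
(* The step condition with [c2], multiplied by a = 1 / c_3. *)
have gk j : (2 <= j <= n)%N -> 2 * gmax ^+ 2 * step t j <= c2 * a.
  move=> /rngN jN; have kj := step_le_max t _ _ jN.
  apply: (@le_trans _ _ (2 * gmax ^+ 2 * step_max t N)).
    by rewrite ler_wpM2l// mulr_ge0.
  rewrite -ler_pdivrMr// /a invrK; apply: le_trans hc2.
  by rewrite le_eqVlt; apply/orP; left; apply/eqP; ring.
have Bb j : (1 <= j <= N)%N -> `|B (t j) (U j)| <= gmax * Vnorm S (U j).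
  move=> jN; have [t0 tN _] := tP.
  have tJ : 0 < t j <= T.
    rewrite -tN (partition_le _ _ _ _ _ tP) ?leqnn ?andbT; last by case/andP: jN.
    have -> : t j = t j.-1 + step t j by rewrite /step addrC subrK.
    rewrite ltr_wpDl ?kpos// -t0 (partition_le _ _ _ _ _ tP)//=.
    by case/andP: jN => _ jN; exact: leq_trans (leq_pred _) jN.
  apply: le_trans (B_le _ tJ _ (dU _ jN)) _.
  by rewrite ler_wpM2r ?normr_ge0//; apply: gamma_le; exists (t j).
have fU0 : 0 <= \sum_(2 <= j < n.+1) step t j * `|Sinv (f (t j))| ^+ 2.
  by apply: sum_nat_ge0 => j jn; rewrite mulr_ge0 ?k0 ?sqr_ge0.
have fG0 : 0 <= \sum_(2 <= j < n.+1) step t j * `|f (t j)| ^+ 2.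
  by apply: sum_nat_ge0 => j jn; rewrite mulr_ge0 ?k0 ?sqr_ge0.
have sumk := sum_step_le _ _ _ _ tP (_ : (2 <= n <= N)%N).
rewrite n2 nN in sumk; have {}sumk := sumk isT.
have T0 : 0 <= T by apply: le_trans sumk; exact: sum_nat_ge0.
pose d j := `|dbar t U j| ^+ 2.
pose v j := Vnorm S (U j) ^+ 2.
pose G j := `|f (t j)| ^+ 2.
pose X := expR (2 * (gmax ^+ 2 * T / a) / (1 - c2)) / (1 - c2).
have incr : \sum_(2 <= j < n.+1) step t j * d j
    <= a^-1 * (1 + 2 * (gmax ^+ 2 * T / a) * X)
       * (v 1%N + step t 2 * d 1%N + 2 / a * \sum_(2 <= j < n.+1) step t j * G j).
  apply: (increments_bound R (step t) (bdf_s t) d v G n a b (gmax ^+ 2) c2 T);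
    rewrite //; try by move=> j; exact: sqr_ge0.
  - move=> j jn; have jN := rngN _ jn; rewrite s_ge0//=.
    by apply: le_trans (s_le _ jN) _; rewrite sig1; lra.
  - move=> j /andP[j2 jn].
    have jN : (2 <= j.+1 <= N)%N.
      by apply/andP; split; [exact: leqW|exact: leq_trans jn nN].
    have kj : 0 < step t j by apply: kpos; have := rng1 _ jN.
    have -> : step t j.+1 = Defs.ratio t j.+1 * step t j.
      by rewrite /Defs.ratio /= divfK// gt_eqF.
    (* [b] is chosen so that 2 b = R * R / (1 + R), the product of the bounds on r_j and s_j. *)
    have -> : 2 * b * step t j = Rb * (Rb / (1 + Rb)) * step t j.
      by rewrite /b; field; rewrite gt_eqF.
    by rewrite mulrAC ler_pM2r// ler_pM ?r_ge0 ?s_ge0 ?r_le ?s_le.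
  - move=> j jn; have jN := rngN _ jn; have j1N := rng1 _ jN.
    have j1 : (1 <= j <= N)%N by case/andP: jN => /ltnW ->.
    have dUj := dU _ j1; have dUj1 := dU _ j1N.
    apply: (increment_test _ hip S t U j _ _ gmax (kpos _ j1) dUj (Bb _ j1));
      rewrite ?s_ge0//.
    exact: scheme (dom_scaleB _ _ _ _ dUj dUj1).
pose e j := `|U j| ^+ 2.
pose q j := step t j ^+ 2 * d j.
pose F j := `|Sinv (f (t j))| ^+ 2.
(* The cutoff makes the summand at n - 1 vanish: [solution_bound] sums up to n - 1, Phi_n only up to
   n - 2. *)
pose phi j := if (j.+2 <= n)%N
  then 2 * pos_part (Defs.ratio t j - Defs.ratio t j.+2) else 0.
(* A lower bound for (1 - s_j) / 2, since s_j <= R / (1 + R). *)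
pose rho := (2 * (1 + Rb))^-1.
have phi0 j : 0 <= phi j.
  by rewrite /phi; case: ifP => // _; rewrite mulr_ge0 ?pos_part_ge0.
have [] := solution_bound R (step t) (fun j => bdf_s t j ^+ 2) phi e q v F n
  a (gmax ^+ 2) rho T n2.
- by rewrite a0.
- by [].
- by rewrite invr_ge0 mulr_ge0// ltW.
- (* [bdf_s t 1] is [0], for [step t 0 = t 0 - t 0] and [x / 0 = 0]. *)
  by rewrite /bdf_s /Defs.ratio /step /= subrr invr0 mulr0 mul0r expr0n.
- exact: phi0.
- by move=> j; exact: sqr_ge0.
- by move=> j; rewrite mulr_ge0 ?sqr_ge0.
- by move=> j; exact: sqr_ge0.
- by move=> j; exact: sqr_ge0.
- exact: k0.
- by move=> j jn; rewrite sqr_ge0 w_le ?rngN.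
- move=> j j2 jn; rewrite /phi jn.
  have j2n : (2 <= j.+2 <= n)%N by [].
  have jn' : (2 <= j <= n)%N by rewrite j2/= ltnW// ltnW.
  by apply: sqr_ratio1DB; rewrite r_ge0// rngN.
- move=> j jn; have := gk j jn.
  have : c2 * a <= a by rewrite ler_piMl ?ltW.
  by lra.
- exact: sumk.
- move=> j jn; have jN := rngN _ jn; have j1N := rng1 _ jN.
  have j1 : (1 <= j <= N)%N by case/andP: jN => /ltnW ->.
  have dUj := dU _ j1.
  have w12 : bdf_s t j ^+ 2 <= 1 / 2 by have := w_le _ jN; lra.
  have := solution_test _ hip S t U j _ _ gmax (kpos _ j1) dUj (Bb _ j1)
    Sinv Sadj Sinv_inv (kpos _ j1N) (s_ge0 _ jN) w12 (scheme _ jN _ dUj).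
  rewrite -/(e j) -/(e j.-1) -/(e j.-2) -/(v j) -/(d j.-1) -/(q j.-1) -/(F j).
  have s0 := s_ge0 _ jN.
  have s1 : bdf_s t j <= 1 - (1 + Rb)^-1 by rewrite -sig1 s_le.
  have kF : 0 <= step t j * F j by rewrite mulr_ge0 ?k0 ?sqr_ge0.
  have ke : 0 <= gmax ^+ 2 * (step t j * e j).
    by rewrite !mulr_ge0 ?k0 ?sqr_ge0.
  have kv : 0 <= step t j * v j by rewrite mulr_ge0 ?k0 ?sqr_ge0.
  have := mulr_ge0 s0 kF; have := mulr_ge0 s0 ke.
  have : 0 <= (1 - (1 + Rb)^-1 - bdf_s t j) * (step t j * v j).
    by rewrite mulr_ge0// subr_ge0.
  have -> : rho = (1 + Rb)^-1 / 2 by rewrite /rho invfM mulrC.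
  by lra.
move=> e_le v_le.
set P := _ + gmax ^+ 2 * T in e_le v_le.
set Z := _ / (a / 2) in e_le v_le.
set D := e 1%N + _ + _ in e_le v_le.
have sum_phi : \sum_(2 <= j < n) phi j <= 2 * Phi t n.
  rewrite /Phi mulr_sumr; case: (ltnP 2 n) => [n3|n2'']; last first.
    by rewrite !big_geq// (leq_trans (leq_pred n)).
  have n1 : (2 <= n.-1)%N by rewrite -ltnS prednK// ltnW// ltnW.
  have phi_last : phi n.-1 = 0.
    by rewrite /phi ifF// prednK ?ltnn// ltnW// ltnW.
  rewrite -[X in \sum_(2 <= j < X) phi j](prednK (ltnW n2)).
  rewrite (@big_nat_recr _ _ _ n.-1)//= phi_last addr0.
  apply: ler_sum_nat => j _; rewrite /phi; case: ifP => // _.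
  by rewrite mulr_ge0 ?pos_part_ge0.
pose Pn := 2 * Phi t n + gmax ^+ 2 * T.
pose Zn := expR (Pn / (a / 2)) / (a / 2).
have ah0 : 0 < a / 2 by rewrite divr_gt0.
have P0 : 0 <= P by rewrite addr_ge0 ?sum_nat_ge0// mulr_ge0.
have PPn : P <= Pn by rewrite lerD2r.
have Z0 : 0 <= Z by rewrite divr_ge0 ?expR_ge0// ltW.
have ZZn : Z <= Zn.
  rewrite ler_wpM2r ?invr_ge0 ?(ltW ah0)// ler_expR.
  by rewrite ler_wpM2r ?invr_ge0 ?(ltW ah0).
set FU := f_U _ _ _ _ _ _ _.
have FUE : FU = e 1%N + step_max t N * v 1%N
    + (step t 1 ^+ 2 + step_max t N * step t 2) * d 1%N
    + (\sum_(2 <= j < n.+1) step t j * F j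
       + step_max t N * \sum_(2 <= j < n.+1) step t j * G j).
  rewrite /FU /f_U; congr (_ + _).
  by rewrite mulr_sumr -big_split/=; apply: eq_bigr => j _; rewrite /F /G; ring.
have fF0 : 0 <= \sum_(2 <= j < n.+1) step t j * F j := fU0.
have e10 : 0 <= e 1%N := sqr_ge0 _.
have kv0 : 0 <= step_max t N * v 1%N by rewrite mulr_ge0 ?sqr_ge0.
have kd0 : 0 <= step t 1 ^+ 2 * d 1%N by rewrite mulr_ge0 ?sqr_ge0.
have kkd0 : 0 <= step_max t N * step t 2 * d 1%N.
  by rewrite !mulr_ge0 ?sqr_ge0// k0.
have kG0 : 0 <= step_max t N * \sum_(2 <= j < n.+1) step t j * G j.
  by rewrite mulr_ge0.
have FU0 : 0 <= FU by rewrite FUE mulrDl !addr_ge0.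
have X0 : 0 <= X by rewrite divr_ge0 ?expR_ge0// subr_ge0 ltW.
pose W := a^-1 * (1 + 2 * (gmax ^+ 2 * T / a) * X).
have W0 : 0 <= W.
  have ia0 : 0 <= a^-1 by rewrite invr_ge0 ltW.
  apply: mulr_ge0 => //; apply: addr_ge0 => //; apply: mulr_ge0 => //.
  by apply: mulr_ge0 => //; apply: mulr_ge0 => //; apply: mulr_ge0.
have ia1 : 1 <= a^-1 by rewrite invf_ge1.
(* Multiplied by k_max, the data of [increments_bound] become the terms k_max |U^1|_V^2, k_max k_2
   |dbar U^1|^2 and k_max k_j |f^j|^2 of f_U. *)
have sum_d : step_max t N * \sum_(2 <= j < n.+1) step t j * d j
    <= 2 / a * W * FU.
  apply: le_trans (ler_wpM2l kmax0 incr) _.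
  have -> : 2 / a * W * FU = W * (2 / a * FU) by ring.
  rewrite -/W mulrCA ler_wpM2l// FUE.
  have i0 : 0 <= a^-1 - 1 by rewrite subr_ge0.
  have := mulr_ge0 i0 kv0; have := mulr_ge0 i0 kkd0.
  have ia0 : 0 <= a^-1 by lra.
  have := mulr_ge0 ia0 e10; have := mulr_ge0 ia0 kd0; have := mulr_ge0 ia0 fF0.
  by lra.
(* The shifted sum starts with [q 1], which is kept apart because [step_max] does not cover the
   first step; it is the term k_1^2 |dbar U^1|^2 of f_U. *)
have sum_q : \sum_(2 <= j < n.+1) q j.-1 <= step t 1 ^+ 2 * d 1%N
    + step_max t N * \sum_(2 <= j < n.+1) step t j * d j.
  rewrite big_add1 /= big_ltn// lerD2l mulr_sumr.
  apply: (@le_trans _ _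
    (\sum_(2 <= j < n) step_max t N * (step t j * d j))).
    apply: ler_sum_nat => j /andP[j2 jn].
    have jn' : (2 <= j <= n)%N by rewrite j2 ltnW.
    rewrite /q expr2 -mulrA ler_wpM2r ?mulr_ge0 ?k0 ?sqr_ge0//.
    by apply: step_le_max; apply: rngN.
  apply: ler_sum_nat_widen => [|j jn]; first by rewrite n2 leqnSn.
  by rewrite !mulr_ge0 ?sqr_ge0// k0// (tail_range _ _ _ _ n2 jn).
have DFU : D <= (2 + 2 / a * W) * FU.
  have -> : (2 + 2 / a * W) * FU = 2 * FU + 2 / a * W * FU by ring.
  have : e 1%N + step t 1 ^+ 2 * d 1%N
      + 2 * \sum_(2 <= j < n.+1) step t j * F j <= 2 * FU.
    by rewrite FUE; lra.
  by rewrite /D; lra.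
have D0 : 0 <= D.
  rewrite !addr_ge0 ?mulr_ge0// ?sum_nat_ge0// => j jn.
  by rewrite mulr_ge0 ?sqr_ge0.
have ZD : Z * D <= Zn * ((2 + 2 / a * W) * FU) by rewrite ler_pM.
have linf : linf_norm 2 n U ^+ 2 <= Zn * ((2 + 2 / a * W) * FU).
  have ZD0 : 0 <= Z * D by rewrite mulr_ge0.
  apply: le_trans ZD; rewrite -[leRHS]sqr_sqrtr//.
  have : linf_norm 2 n U <= Num.sqrt (Z * D).
    rewrite /linf_norm big_nat; apply: bigmax_le => [|j jn]; first exact: sqrtr_ge0.
    rewrite -(ler_sqr (normr_ge0 _) (sqrtr_ge0 _)) sqr_sqrtr//.
    exact: e_le.
  rewrite ler_sqr ?nnegrE ?sqrtr_ge0//.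
  exact: bigmax_ge_id.
have l2 : l2V_norm t S 2 n U ^+ 2
    <= 2 * (1 + Rb) * (1 + Zn * (1 + Pn)) * ((2 + 2 / a * W) * FU).
  rewrite /l2V_norm sqr_sqrtr; last first.
    by apply: sum_nat_ge0 => j jn; rewrite mulr_ge0 ?k0 ?sqr_ge0.
  rewrite -mulrA -ler_pdivrMl ?mulr_gt0//; apply: le_trans v_le _.
  have P10 : 0 <= 1 + P by rewrite addr_ge0.
  rewrite ler_pM ?lerD2l//; first by rewrite addr_ge0// mulr_ge0.
  by rewrite ler_pM ?lerD2l.
rewrite -/Pn -/Zn -/X -/W; apply: le_trans (lerD linf l2) _.
by rewrite le_eqVlt; apply/orP; left; apply/eqP; ring.
Qed.
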